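(* Let $\mathcal{U}$ be a small category and $\mathcal{A}$ a quiver on $\mathcal{U}$. Then $s^{-1}\mathbf{C}_{GS}(\mathcal{A})$ is an $L_\infty$-admissible subalgebra of $\mathrm{Tot}(s_{\mathrm{thin}}^{-1}\mathbf{C}_\square^{\bullet,\bullet,\bullet}(\mathcal{A}))$; that is, it is a graded submodule closed under all the operations $P_n$, $n\ge2$.
   Context: $k$ is a commutative ring, $\mathbb{N}=\{0,1,2,\dots\}$. Operads are symmetric, possibly coloured, with partial compositions $\circ_i$, full compositions, right symmetric group actions; $x\circ(-,x_2,\dots,x_n)$ means that the first input is left uncomposed; $1$ denotes operadic identities. **The operad $\square\mathsf{p}$ and box operads.** $\square\mathsf{p}$ is the $\mathbb{N}^3$-coloured symmetric operad in sets generated by: for all $n\ge 0$ and $q_1,\dots,q_n,p_0,\dots,p_n,p,r\in\mathbb{N}$ an element $C^{p_0,\dots,p_n;p,r}_{q_1,\dots,q_n}\in\square\mathsf{p}((p,n,r),(p_0,q_1,p_1),\dots,(p_{n-1},q_n,p_n);(p+p_0,\sum_{i} q_i,r+p_n))$ and $\eta\in\square\mathsf{p}(\,;(0,1,0))$, subject to unit relations $C^{p,r;0,0}_{q}\circ_1\eta=1$, $C^{0,\dots,0;p,r}_{1,\dots,1}\circ(-,\eta,\dots,\eta)=1$ and to the associativity relations expressing, on algebras, that with $\mu(x;x_1,\dots,x_n)$ the operation of $C$ one has $\mu(\mu(x;x_1,\dots,x_n);x_1^1,\dots,x^n_{m_n})=\mu(x;\mu(x_1;x^1_1,\dots,x^1_{m_1}),\dots,\mu(x_n;x^n_1,\dots,x^n_{m_n}))$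 for $x,x_i,x^i_j$ of colours $(p,n,r)$, $(p_{i-1},m_i,p_i)$, $(p^i_{j-1},q^i_j,p^i_j)$ with $p^i_{m_i}=p^{i+1}_0$ for $0<i<n$ (if $m_i=0$, a number $p^i_0$ is still part of the data). A (linear) box operad $\mathcal{B}$ is an algebra over the linearisation $k\square\mathsf{p}$: $k$-modules $\mathcal{B}(p,q,r)$, composition maps $\mathcal{B}(p,n,r)\otimes\bigotimes_i\mathcal{B}(p_{i-1},q_i,p_i)\to\mathcal{B}(p+p_0,\sum q_i,r+p_n)$ (one for each $p_0$ if $n=0$), and a unit in $\mathcal{B}(0,1,0)$, satisfying these axioms. An element $S$ of $\square\mathsf{p}$ with $n$ inputs is called a stacking of $n$ boxes, its input colours $(p_i,q_i,r_i)$ being its boxes. **Types, standard order, graph.** A box $(p,q,r)$ is thin if $p=r=0$; semi-thin if $(p,r)\ne(0,0)$ and ($p=0$ or $r=0$); non-thin otherwise. The stackings in standard order are the smallest collection containing operadic identities and $\eta$, and containing $C\circ(-,S_1,\dots,S_n)$, for $C$ a generator, whenever it contains $S_1,\dots,S_n$ ($n\ge0$). The horizontal composite graph $\mathbb{H}_S$ has vertices the boxes of $S$, vertex $i$ having $p_i$ ordered inputs and $r_i$ ordered outputs, and is determined by: the identity gives a single vertex; $\eta$ gives the empty graph; $C^{p_0,\dots,p_n;p,r}_{q_1,\dots,q_n}$ gives the disjoint juxtaposition of vertex 1 (first) with the serial composite of vertices $2,\dots,n+1$ (the $j$-th output of each joined to the $j$-th input of the next; for $n=0$, $p_0$ wires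 joining inputs directly to outputs); composition corresponds to substitution of graphs in vertices. Vertices without edges and wires without vertices count as connected components. **Signs and braces.** $\mathrm{td}(p,q,r)=p-r+q$ if $(p,r)\neq(0,0)$, $\mathrm{td}(0,q,0)=q-1$; $\mathrm{d}(p,q,r)=p-r+q-1$. For a stacking $S$ with output $(p,q,r)$, $|S^{\mathrm{td}}|=\mathrm{td}(p,q,r)-\sum_i\mathrm{td}(p_i,q_i,r_i)$. The sign $(-1)^{S^{\mathrm d}}$ is determined by: $(-1)^{\eta}=1$; for $C^{p_0,\dots,p_n;p,r}_{q_1,\dots,q_n}$ it is $(-1)^{(p_0+p_n)r+\sum_i(q_i-1)(n-i)+\sum_i(q_i-1)(p-r+p_0-p_{i-1})}$; it is multiplicative under $\circ_i$; and $(-1)^{(S^\sigma)^{\mathrm d}}=(-1)^{S^{\mathrm d}}$ times the Koszul sign of permuting elements of degrees $\mathrm{d}(p_i,q_i,r_i)$. Put $(-1)^{S^{\mathrm{td}}}=(-1)^{S^{\mathrm d}+n+\sum_{t=1}^n\mathrm{td}(p_t,q_t,r_t)N_t}$, with $N_t$ the number of non-thin boxes of index $>t$. $S$ (with $n$ boxes) is thin-quadratic if $|S^{\mathrm{td}}|=2-n$, $S$ is in standard order, $\mathbb{H}_S$ has exactly two connected components and $S$ has no semi-thin boxes. **The operations on a box operad.** $\mathrm{Tot}(s^{-1}_{\mathrm{thin}}\mathcal{B})$ is the graded $k$-module with degree $n$ part $\prod_{\mathrm{td}(p,q,r)=n}\mathcal{B}(p,q,r)$; $\theta\in\mathcal{B}(p,q,r)$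 is written $\theta^{\mathrm{td}}$ there. For $\theta_i\in\mathcal{B}(p_i,q_i,r_i)$ put $$S^{\mathrm{td}}(\theta_1^{\mathrm{td}},\dots,\theta_n^{\mathrm{td}})=(-1)^{\frac{|S^{\mathrm{td}}|(|S^{\mathrm{td}}|+1)}2+|S^{\mathrm{td}}|\mathrm{td}(p,q,r)+\sum_i|\theta_i^{\mathrm{td}}|\sum_{j>i}\mathrm{td}(p_j,q_j,r_j)}S(\theta_1,\dots,\theta_n)^{\mathrm{td}},$$ and $P_n=\sum_S(-1)^{S^{\mathrm{td}}}S^{\mathrm{td}}$, the sum being over all thin-quadratic stackings of $n$ boxes, extended to the product. $P_n$ has degree $2-n$. A graded module with zero differential and operations $P_n$ ($n\ge 2$) of degree $2-n$ is an $L_\infty$-admissible algebra if for all $n$: $\sum_{k+l=n+1;k,l\ge2}\sum_{\sigma\in\Sigma_n}\sum_{j=1}^k(-1)^{(k-1)l+(j-1)(l-1)}(-1)^\sigma(P_k\circ_jP_l)^\sigma=0$; the operations $P_n=\sum_S(-1)^{S^{\mathrm{td}}}S^{\mathrm{td}}$ ($n\ge2$, $S$ ranging over all thin-quadratic stackings of $n$ boxes), taken for the box operad $\mathcal{B}=\mathbf{C}_\square(\mathcal{A})$, form such a structure on $\mathrm{Tot}(s^{-1}_{\mathrm{thin}}\mathbf{C}_\square(\mathcal{A}))$. **The Gerstenhaber–Schack box operad.** A quiver $\mathcal{A}$ on $\mathcal{U}$ consists of: for each object $U$ of $\mathcal{U}$ a $k$-quiver $\mathcal{A}(U)$ (a set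 of objects $\mathrm{Ob}(\mathcal{A}(U))$ and $k$-modules $\mathcal{A}(U)(A,A')$), and for each $u:V\to U$ a function $u^*:\mathrm{Ob}(\mathcal{A}(U))\to\mathrm{Ob}(\mathcal{A}(V))$ (no further conditions). For a $p$-simplex $\sigma=(U_0\xrightarrow{u_1}\cdots\xrightarrow{u_p}U_p)$ of $\mathcal{U}$ put $\sigma^*=u_1^*\circ\cdots\circ u_p^*$ (identity if $p=0$). $\Delta^{inj}_f(r,p)$ is the set of strictly increasing maps $f:[r]\to[p]$, $[n]=\{0,\dots,n\}$, with $f(0)=0$, $f(r)=p$; $f(\sigma)$ is the $r$-simplex $U_{f(0)}\to U_{f(1)}\to\cdots\to U_{f(r)}$ with composed arrows. For $p\ge r$, $$\mathbf{C}_\square^{p,q,r}(\mathcal{A})=\prod_{\sigma,\ f\in\Delta^{inj}_f(r,p)}\ \prod_{A_0,\dots,A_q\in\mathcal{A}(U)}\mathrm{Hom}_k\Big(\bigotimes_{i=1}^q\mathcal{A}(U)(A_{i-1},A_i),\mathcal{A}(V)(\sigma^*A_0,f(\sigma)^*A_q)\Big),$$ with $\sigma$ ranging over $p$-simplices, $V=U_0$, $U=U_p$; it is $0$ for $p<r$. For $\theta\in\mathbf{C}_\square^{p,q,r}$, $\theta'\in\mathbf{C}_\square^{r,q',t}$, put $(\theta\otimes_{\mathcal{A}}\theta')^{\sigma,f}_{(A_0,\dots,A_{q+q'})}=\sum_{f=f_1\circ f_2}\theta^{\sigma,f_1}_{(A_0,\dots,A_q)}\otimes\theta'^{f_1(\sigma),f_2}_{(A_q,\dots,A_{q+q'})}$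 ($f_1\in\Delta_f^{inj}(r,p)$, $f_2\in\Delta^{inj}_f(t,r)$), and iterate. The composition is: for $\sigma$ a $(p+p_0)$-simplex and $f\in\Delta^{inj}_f(r+p_n,p+p_0)$ with $f(r)=p$, $(\theta\circ(\theta_1,\dots,\theta_n))^{\sigma,f}=\theta^{\sigma_{\le p},f_{\le r}}\circ(\theta_1\otimes_{\mathcal{A}}\cdots\otimes_{\mathcal{A}}\theta_n)^{\sigma_{>p},f_{>r}}$, and $0$ if $f(r)\ne p$; here $\sigma_{\le p}$ consists of the first $p$ arrows, $\sigma_{>p}$ of the remaining $p_0$ arrows, $f_{\le r}$ is the restriction of $f$ to $[r]$, and $f_{>r}(j)=f(r+j)-p$ (for $n=0$ the empty tensor is trivial and $f_{>r}=\mathrm{id}$). The unit is the identity in $\mathbf{C}_\square^{0,1,0}(\mathcal{A})$. This is a box operad. **The Gerstenhaber–Schack object.** $\mathbf{C}_{GS}^{0,q}(\mathcal{A})=\mathbf{C}_\square^{0,q,0}(\mathcal{A})$, $\mathbf{C}_{GS}^{p,q}(\mathcal{A})=\mathbf{C}_\square^{p,q,1}(\mathcal{A})$ for $p\ge1$, $\mathbf{C}_{GS}^n(\mathcal{A})=\bigoplus_{p+q=n}\mathbf{C}^{p,q}_{GS}(\mathcal{A})$; $s^{-1}\mathbf{C}_{GS}(\mathcal{A})$ has degree $n$ part $\mathbf{C}^{n+1}_{GS}(\mathcal{A})$ and is thereby a graded submodule of $\mathrm{Tot}(s^{-1}_{\mathrm{thin}}\mathbf{C}_\square(\mathcal{A}))$.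 *)

(* Defs.v *)
From HB Require Import structures.
From mathcomp Require Import all_boot all_order all_algebra.
From mathcomp Require Import generic_quotient boolp classical_sets fsbigop.

Set Implicit Arguments.
Unset Strict Implicit.
Unset Printing Implicit Defensive.

Import GRing.Theory.
Local Open Scope ring_scope.
Local Open Scope quotient_scope.

Definition colour := (nat * nat * nat)%type.

(* [chain F p0 [:: (q1, p1); ..; (qn, pn)]] consists of x_1, .., x_n with x_i in
   F (p_(i-1), q_i, p_i); for n = 0 the number p0 is the only datum. *)
Inductive chain (F : colour -> Type) : nat -> seq (nat * nat) -> Type :=
| cnil p0 : chain F p0 [::]
| ccons p0 q p1 l :
    F (p0, q, p1) -> chain F p1 l -> chain F p0 ((q, p1) :: l).
Arguments cnil {F} p0.
Arguments ccons {F p0 q p1 l}.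

Definition cqs (l : seq (nat * nat)) := sumn (map fst l).
Definition clast (p0 : nat) (l : seq (nat * nat)) := last p0 (map snd l).
(* Output colour of C^(p_0,..,p_n; p,r)_(q_1,..,q_n). *)
Definition mu_colour (p r p0 : nat) l : colour :=
  ((p + p0)%N, cqs l, (r + clast p0 l)%N).

Fixpoint ccat (F : colour -> Type) p0 l (xs : chain F p0 l) l' :
    chain F (clast p0 l) l' -> chain F p0 (l ++ l') :=
  match xs in chain _ p0 l return chain F (clast p0 l) l' -> chain F p0 (l ++ l')
  with
  | cnil _ => id
  | ccons _ _ _ _ x xs' => fun ys => ccons x (ccat xs' ys)
  end.

Fixpoint cmap (F F' : colour -> Type) (f : forall c, F c -> F' c) p0 l
    (xs : chain F p0 l) : chain F' p0 l :=
  match xs with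
  | cnil p0 => cnil p0
  | ccons _ _ _ _ x xs' => ccons (f _ x) (cmap f xs')
  end.

Definition thin (c : colour) := (c.1.1 == 0%N) && (c.2 == 0%N).
Definition semithin (c : colour) := ~~ thin c && ((c.1.1 == 0%N) || (c.2 == 0%N)).
Definition nonthin (c : colour) := ~~ thin c && ~~ semithin c.

Definition td (c : colour) : int :=
  let: (p, q, r) := c in
  if (p == 0) && (r == 0) then q%:Z - 1 else p%:Z - r%:Z + q%:Z.
Definition dd (c : colour) : int := let: (p, q, r) := c in p%:Z - r%:Z + q%:Z - 1.

(* Terms presenting the operad □p.  An element of the free coloured symmetric
   operad on C and eta is a tree whose leaves are labelled bijectively by the inputs,
   that is a term in which each variable [var i] of colour [G i] occurs exactly once
   ([linear_term] below).  The generator C is [mu (var 0) (var 1, .., var n)], partial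
   composition is substitution, and permutations rename the variables. *)
Section Terms.
Variables (n : nat) (G : {ffun 'I_n -> colour}).

Inductive term : colour -> Type :=
| var i c : G i = c -> term c
| eta : term (0, 1, 0)%N
| mu p m r p0 l : term (p, m, r) -> chain term p0 l -> size l = m ->
    term (mu_colour p r p0 l).

Fixpoint etas m : chain term 0 (nseq m (1, 0)%N) :=
  if m is m'.+1 then ccons eta (etas m') else cnil 0.

(* [nested xs yss zs]: [xs] is x_1, .., x_n, [yss] is the concatenation of the
   chains x^i_1, .., x^i_(m_i), which meet at p^i_(m_i) = p^(i+1)_0, and [zs] is the
   chain of the mu(x_i; x^i_1, .., x^i_(m_i)). *)
Inductive nested : forall p0 l p0' l' l'',
    chain term p0 l -> chain term p0' l' -> chain term (p0 + p0') l'' -> Prop :=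
| nested_nil p0 p0' : nested (cnil p0) (cnil p0') (cnil (p0 + p0'))
| nested_cons p0 m p1 l p0' li l' l'' (x : term (p0, m, p1)) (xs : chain term p1 l)
    (ys : chain term p0' li) (yss : chain term (clast p0' li) l')
    (zs : chain term (p1 + clast p0' li) l'') (e : size li = m) :
    nested xs yss zs ->
    nested (ccons x xs) (ccat ys yss) (ccons (mu x ys e) zs).

(* The congruence generated by the unit and associativity relations.  It is stated
   across colours because the colours of both sides, such as (p + p0) + p0' and
   p + (p0 + p0'), are equal but not convertible. *)
Inductive eqv : forall c c', term c -> term c' -> Prop :=
| eqv_refl c (t : term c) : eqv t t
| eqv_sym c c' (t : term c) (t' : term c') : eqv t t' -> eqv t' t
| eqv_trans c c' c'' (t : term c) (t' : term c') (t'' : term c'') :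
    eqv t t' -> eqv t' t'' -> eqv t t''
| eqv_mu p m r p0 l p' m' r' p0' l' (x : term (p, m, r)) (x' : term (p', m', r'))
    (ys : chain term p0 l) (ys' : chain term p0' l')
    (e : size l = m) (e' : size l' = m') :
    eqv x x' -> eqvs ys ys' -> eqv (mu x ys e) (mu x' ys' e')
| eqv_unitl p q r (y : term (p, q, r)) (e : size [:: (q, r)] = 1%N) :
    eqv (mu eta (ccons y (cnil r)) e) y
| eqv_unitr p m r (x : term (p, m, r)) (e : size (nseq m (1, 0)%N) = m) :
    eqv (mu x (etas m) e) x
| eqv_assoc p m r (x : term (p, m, r)) p0 l p0' l' l''
    (xs : chain term p0 l) (yss : chain term p0' l')
    (zs : chain term (p0 + p0') l'')
    (e : size l = m) (e' : size l' = cqs l) (e'' : size l'' = m) :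
    nested xs yss zs -> eqv (mu (mu x xs e) yss e') (mu x zs e'')
with eqvs : forall p0 l p0' l', chain term p0 l -> chain term p0' l' -> Prop :=
| eqvs_nil p0 : eqvs (cnil p0) (cnil p0)
| eqvs_cons p0 q p1 l p0' q' p1' l' (y : term (p0, q, p1)) (ys : chain term p1 l)
    (y' : term (p0', q', p1')) (ys' : chain term p1' l') :
    eqv y y' -> eqvs ys ys' -> eqvs (ccons y ys) (ccons y' ys').

Section ChainFold.
Variables (T : Type) (z : nat -> T) (f : forall c, term c -> T) (op : T -> T -> T).
Fixpoint cfold p0 l (ys : chain term p0 l) : T :=
  match ys with
  | cnil p0 => z p0
  | ccons _ _ _ _ y ys' => op (f y) (cfold ys')
  end.
End ChainFold.

(* The inputs of a term in reading order, which is the input order of the composite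
   of generators underlying it. *)
Fixpoint boxes c (t : term c) : seq 'I_n :=
  match t with
  | var i _ _ => [:: i]
  | eta => [::]
  | mu _ _ _ _ _ x ys _ => boxes x ++ cfold (fun=> [::]) boxes cat ys
  end.

(* The shape C o (-, S_1, .., S_n) of stackings in standard order.  As the boxes of
   such a composite are numbered consecutively, standard order also requires
   [boxes t = enum 'I_n]; see [in_standard_order]. *)
Inductive standard : forall c, term c -> Prop :=
| standard_var i c (e : G i = c) : standard (var e)
| standard_eta : standard eta
| standard_mu i p m r (e : G i = (p, m, r)) p0 l (ys : chain term p0 l)
    (e' : size l = m) : standards ys -> standard (mu (var e) ys e')
with standards : forall p0 l, chain term p0 l -> Prop :=
| standards_nil p0 : standards (cnil p0)
| standards_cons p0 q p1 l (y : term (p0, q, p1)) (ys : chain term p1 l) :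
    standard y -> standards ys -> standards (ccons y ys).

(* A horizontal composite graph is a list of wires (source, target).  As a source,
   [inl j] is the j-th global input and [inr (i, j)] the j-th output of vertex i; as a
   target, [inl j] is the j-th global output and [inr (i, j)] the j-th input of i. *)
Definition port := (nat + 'I_n * nat)%type.
Definition wiring := seq (port * port).

Definition at_box (i : 'I_n) (a : port) := if a is inr (j, _) then j == i else false.

(* [p] and [r] count the global inputs and outputs of [w]. *)
Definition juxtapose (p r : nat) (w w' : wiring) : wiring :=
  let shift k (a : port) := if a is inl j then inl (k + j)%N else a in
  w ++ [seq (shift p a.1, shift r a.2) | a <- w'].

Definition external (a : port) := if a is inl _ then true else false.

Definition serial (w w' : wiring) : wiring :=
  [seq a <- w | ~~ external a.2] ++ [seq a <- w' | ~~ external a.1] ++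
  flatten [seq [seq (a.1, a'.2) | a' <- w' & external a'.1 && (a'.1 == a.2)] | a <- w].

Definition vertex (i : 'I_n) : wiring :=
  [seq (inl j, inr (i, j)) | j <- iota 0 (G i).1.1] ++
  [seq (inr (i, j), inl j) | j <- iota 0 (G i).2].

(* Serial composition with the final p_n parallel wires changes nothing when n > 0, and
   gives the p_0 wires when n = 0. *)
Fixpoint hgraph c (t : term c) : wiring :=
  match t with
  | var i _ _ => vertex i
  | eta => [::]
  | mu p _ r _ _ x ys _ =>
      juxtapose p r (hgraph x)
        (cfold (fun p0 => [seq (inl j, inl j) | j <- iota 0 p0]) hgraph serial ys)
  end.

(* Vertices and wires are both nodes here, so that isolated vertices and wires
   without vertices count as components. *)
Definition adjacent (w : wiring) : rel ('I_n + 'I_(size w)) :=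
  fun a b => match a, b with
  | inl i, inr j | inr j, inl i =>
      let: (s, t) := tnth (in_tuple w) j in at_box i s || at_box i t
  | _, _ => false
  end.

Definition ncomponents (w : wiring) := n_comp (@adjacent w) predT.

(* Indices are shifted by one: [q i] is q_(i+1) and [p_ i] is p_i. *)
Definition generator_exp (p r p0 : nat) (l : seq (nat * nat)) : int :=
  let n := size l in
  let q i := (nth 0%N (map fst l) i)%:Z in
  let p_ i := (nth 0%N (p0 :: map snd l) i)%:Z in
  (p_ 0%N + p_ n) * r%:Z
  + \sum_(i < n) (q i - 1) * (n - i.+1)%:Z
  + \sum_(i < n) (q i - 1) * (p%:Z - r%:Z + p_ 0%N - p_ i).

Fixpoint generators_exp c (t : term c) : int :=
  match t with
  | mu p _ r p0 l x ys _ =>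
      generator_exp p r p0 l + generators_exp x + cfold (fun=> 0) generators_exp +%R ys
  | _ => 0
  end.

Fixpoint koszul_exp (s : seq 'I_n) : int :=
  if s is i :: s' then \sum_(j <- s' | (j < i)%N) dd (G i) * dd (G j) + koszul_exp s'
  else 0.

(* (-1)^(S^d) is (-1) to the power [d_exp t], for any representative t of S. *)
Definition d_exp c (t : term c) : int := generators_exp t + koszul_exp (boxes t).

End Terms.

Section Stackings.
Variables (n : nat) (G : {ffun 'I_n -> colour}) (c : colour).

Record linear_term := LinearTerm {
  term_of :> term G c;
  term_ofP : perm_eq (boxes term_of) (enum 'I_n) }.

HB.instance Definition _ := gen_eqMixin linear_term.
HB.instance Definition _ := gen_choiceMixin linear_term.

Definition eqvb : rel linear_term := fun t t' => `[< eqv t t' >].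

Lemma eqvb_equiv : equiv_class_of eqvb.
Proof.
split=> [t|t t'|t t' t''].
- exact/asboolP/eqv_refl.
- by apply/asboolP/asboolP => /eqv_sym.
- by move=> /asboolP h /asboolP h'; apply/asboolP/(eqv_trans h h').
Qed.

Canonical eqvb_rel := EquivRelPack eqvb_equiv.

(* □p (G 0, .., G (n-1); c). *)
Definition boxop := {eq_quot eqvb_rel}.
HB.instance Definition _ := Choice.on boxop.
HB.instance Definition _ := EqQuotient.on boxop.

End Stackings.

Definition stacking n c := {G : {ffun 'I_n -> colour} & boxop G c}.

Section Thin.
Variables (n : nat) (c : colour).
Implicit Type S : stacking n c.

Definition inputs S : {ffun 'I_n -> colour} := tag S.
(* Signs, graphs and operations are read off a chosen representative; the parity of
   [d_exp], the graph and the value of [eval] in a box operad are invariant under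
   [eqv]. *)
Definition rep S : linear_term (inputs S) c := repr (tagged S).

Definition td_deg S : int := td c - \sum_i td (inputs S i).

Definition td_exp S : int :=
  d_exp (rep S) + n%:Z
  + \sum_t td (inputs S t) * #|[set u : 'I_n | (t < u)%N & nonthin (inputs S u)]|%:Z.

Definition in_standard_order S : Prop :=
  exists t : linear_term (inputs S) c,
    [/\ \pi_(boxop (inputs S) c) t = tagged S, standard t & boxes t = enum 'I_n].

Definition thin_quadratic S : Prop :=
  [/\ td_deg S = 2 - n%:Z, in_standard_order S, ncomponents (hgraph (rep S)) = 2%N
    & forall i, ~~ semithin (inputs S i)].
End Thin.

(* The data of a box operad.  Its unit and associativity axioms express that [eval]
   below is invariant under [eqv]. *)
Record box_structure (k : comPzRingType) := BoxStructure {
  bmod :> colour -> lmodType k;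
  bcomp : forall p m r p0 l, bmod (p, m, r) -> chain bmod p0 l -> size l = m ->
    bmod (mu_colour p r p0 l);
  bunit : bmod (0, 1, 0)%N }.

Section Operations.
Variables (k : comPzRingType) (B : box_structure k).

Fixpoint eval n (G : {ffun 'I_n -> colour}) (x : forall i, B (G i)) c (t : term G c) :
    B c :=
  match t with
  | var i c e => ecast c (B c) e (x i)
  | eta => bunit B
  | mu _ _ _ _ _ y ys e => bcomp (eval x y) (cmap (eval x) ys) e
  end.

Definition sign (e : int) : k := (-1) ^+ `|e|%N.

(* The degree d part of Tot(s^-1_thin B). *)
Definition Tot (d : int) := forall c, td c = d -> B c.

Definition component d (x : Tot d) c : B c :=
  if td c =P d is ReflectT e then x c e else 0.

(* S^td, applied to elements of B. *)
Definition td_op n c (S : stacking n c) (x : forall i, B (inputs S i)) : B c :=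
  sign ((td_deg S * (td_deg S + 1) %/ 2)%Z + td_deg S * td c
        + \sum_i td (inputs S i) * \sum_(j : 'I_n | (i < j)%N) td (inputs S j))
  *: eval x (rep S).

Arguments td_op {n c} S x.

(* [\sum_(S \in _)] is a sum of finite support.  For a fixed output colour c and fixed
   degrees d i only finitely many S contribute: S is a tree with n boxes and c.1.2
   copies of eta, the q_i satisfy \sum_i q_i = c.1.2 + n - 1, the differences
   p_i - r_i are then determined by the d i, and all the p_i are bounded inductively,
   starting from c.1.1. *)
Definition Linfty_op n (d : 'I_n -> int) (x : forall i, Tot (d i)) :
    Tot (2 - n%:Z + \sum_i d i) :=
  fun c _ => \sum_(S \in [set S : stacking n c | thin_quadratic S])
    sign (td_exp S) *: td_op S (fun i => component (x i) (inputs S i)).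

HB.instance Definition _ d := gen_eqMixin (Tot d).
HB.instance Definition _ d := gen_choiceMixin (Tot d).

Section TotModule.
Variable d : int.
Implicit Types x y z : Tot d.

Lemma TotP x y : (forall c e, x c e = y c e) -> x = y.
Proof. by move=> h; do 2!apply: functional_extensionality_dep => ?; apply: h. Qed.

Definition Tot0 : Tot d := fun _ _ => 0.
Definition TotN x : Tot d := fun c e => - x c e.
Definition TotD x y : Tot d := fun c e => x c e + y c e.
Definition TotZ (l : k) x : Tot d := fun c e => l *: x c e.

Lemma TotDA : associative TotD.
Proof. by move=> x y z; apply: TotP => c e; apply: addrA. Qed.
Lemma TotDC : commutative TotD.
Proof. by move=> x y; apply: TotP => c e; apply: addrC. Qed.
Lemma Tot0D : left_id Tot0 TotD.
Proof. by move=> x; apply: TotP => c e; apply: add0r. Qed.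
Lemma TotND : left_inverse Tot0 TotN TotD.
Proof. by move=> x; apply: TotP => c e; apply: addNr. Qed.

HB.instance Definition _ := GRing.isZmodule.Build (Tot d) TotDA TotDC Tot0D TotND.

Lemma TotZA l l' x : TotZ l (TotZ l' x) = TotZ (l * l') x.
Proof. by apply: TotP => c e; apply: scalerA. Qed.
Lemma Tot1Z : left_id 1 TotZ.
Proof. by move=> x; apply: TotP => c e; apply: scale1r. Qed.
Lemma TotZDr : right_distributive TotZ +%R.
Proof. by move=> l x y; apply: TotP => c e; apply: scalerDr. Qed.
Lemma TotZDl x : {morph TotZ^~ x : l l' / l + l'}.
Proof. by move=> l l'; apply: TotP => c e; apply: scalerDl. Qed.

HB.instance Definition _ := GRing.Zmodule_isLmodule.Build k (Tot d)
  TotZA Tot1Z TotZDr TotZDl.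

End TotModule.

Definition graded_submodule (M : forall d, Tot d -> Prop) : Prop :=
  forall d, M d 0 /\ forall (l : k) (x y : Tot d), M d x -> M d y -> M d (l *: x + y).

Definition Linfty_admissible_subalgebra (M : forall d, Tot d -> Prop) : Prop :=
  graded_submodule M /\
  forall n : nat, (2 <= n)%N -> forall (d : 'I_n -> int) (x : forall i, Tot (d i)),
    (forall i, M (d i) (x i)) -> M _ (Linfty_op x).

End Operations.

Record smallCat := SmallCat {
  obj : Type;
  arr : obj -> obj -> Type;
  idarr : forall U, arr U U;
  comparr : forall U V W, arr V W -> arr U V -> arr U W;
  compIl : forall U V (u : arr U V), comparr (idarr V) u = u;
  compIr : forall U V (u : arr U V), comparr u (idarr U) = u;
  compA : forall U V W X (w : arr W X) (v : arr V W) (u : arr U V),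
    comparr w (comparr v u) = comparr (comparr w v) u }.
Arguments idarr {s}.
Arguments comparr {s U V W}.

Record kQuiver (k : comPzRingType) := KQuiver {
  qob :> Type;
  qhom : qob -> qob -> lmodType k }.
Arguments qhom {k _}.

(* No compatibility of [res] with identities and composition is required. *)
Record quiverOn (k : comPzRingType) (U : smallCat) := QuiverOn {
  qv :> obj U -> kQuiver k;
  res : forall V W : obj U, arr V W -> qv W -> qv V }.

(* Composable arrows together with the objects between them: an element of
   [mpath H q a b] is given by a = A_0, .., A_q = b and a_i in H A_(i-1) A_i. *)
Inductive mpath (O : Type) (H : O -> O -> Type) : nat -> O -> O -> Type :=
| pnil a : mpath H 0 a a
| pcons n a b c : H a b -> mpath H n b c -> mpath H n.+1 a c.
Arguments pnil {O H}.
Arguments pcons {O H n a b c}.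

Fixpoint msplit O (H : O -> O -> Type) m n a c :
    mpath H (m + n) a c -> {b & (mpath H m a b * mpath H n b c)%type} :=
  match m return mpath H (m + n) a c -> {b & (mpath H m a b * mpath H n b c)%type}
  with
  | 0 => fun w => existT _ a (pnil a, w)
  | m'.+1 => fun w =>
    match w in mpath _ j a c return j = (m' + n).+1 ->
      {b & (mpath H m'.+1 a b * mpath H n b c)%type} with
    | pnil _ => fun e => False_rect _ (O_S _ e)
    | pcons j a b c u w' => fun e =>
      let w'' := ecast i (mpath H i b c) (congr1 predn e) w' in
      let: existT b' (w1, w2) := msplit w'' in
      existT _ b' (pcons u w1, w2)
    end erefl
  end.

Definition mend O (H : O -> O -> Type) n a c c' (e : c = c') (w : mpath H n a c) :=
  ecast x (mpath H n a x) e w.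

(* For fixed A_0 = a, .., A_q the map is k-linear in each of the q arrows, so that [F]
   is a family of elements of Hom_k(H A_0 A_1 (x) .. (x) H A_(q-1) A_q, N A_q). *)
Fixpoint multilin (k : comPzRingType) (O : Type) (H : O -> O -> lmodType k)
    n a (N : O -> lmodType k) (F : forall c, mpath H n a c -> N c) : Prop :=
  match n return (forall c, mpath H n a c -> N c) -> Prop with
  | 0 => fun _ => True
  | n'.+1 => fun F => forall b,
      (forall c (w : mpath H n' b c), linear (fun u : H a b => F c (pcons u w)))
      /\ (forall u : H a b, multilin (fun c w => F c (pcons u w)))
  end F.

Section Simplices.
Variable U : smallCat.

Inductive simplex : obj U -> obj U -> Type :=
| snil V : simplex V V
| scons V W X : arr V W -> simplex W X -> simplex V X.

Fixpoint slen V X (s : simplex V X) : nat :=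
  if s is scons _ _ _ _ s' then (slen s').+1 else 0%N.

Definition psimplex (p : nat) V X := {s : simplex V X | slen s == p}.

(* The composite of the first m arrows, and the remaining arrows. *)
Fixpoint scut (m : nat) V X (s : simplex V X) : {W & (arr V W * simplex W X)%type} :=
  match s in simplex V X return {W & (arr V W * simplex W X)%type} with
  | snil V => existT _ V (idarr V, snil V)
  | scons V W X u s' =>
    if m is m'.+1 then
      let: existT Y (v, s'') := scut m' s' in existT _ Y (comparr v u, s'')
    else existT _ V (idarr V, scons u s')
  end.

(* Composes the arrows in successive groups of sizes [gs]. *)
Fixpoint sface (gs : seq nat) V X (s : simplex V X) : simplex V X :=
  if gs is g :: gs' then
    let: existT W (v, s') := scut g s in scons v (sface gs' s')
  else s.

Fixpoint ssplit (m : nat) V X (s : simplex V X) :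
    {W & (simplex V W * simplex W X)%type} :=
  match s in simplex V X return {W & (simplex V W * simplex W X)%type} with
  | snil V => existT _ V (snil V, snil V)
  | scons V W X u s' =>
    if m is m'.+1 then
      let: existT Y (s1, s2) := ssplit m' s' in existT _ Y (scons u s1, s2)
    else existT _ V (snil V, scons u s')
  end.

End Simplices.
Arguments snil {U}.
Arguments scons {U V W X}.

Section Pullback.
Variables (k : comPzRingType) (U : smallCat) (A : quiverOn k U).
Fixpoint spull V X (s : simplex V X) : A X -> A V :=
  match s in simplex V X return A X -> A V with
  | snil _ => id
  | scons _ _ _ u s' => fun a => res u (spull s' a)
  end.
End Pullback.
Arguments spull {k U} A {V X}.

(* Delta^inj_f(r, p). *)
Definition is_dinj r p (f : {ffun 'I_r.+1 -> 'I_p.+1}) :=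
  [&& [forall i : 'I_r.+1, forall j : 'I_r.+1, (i < j)%N ==> (f i < f j)%N],
      f ord0 == ord0 & f ord_max == ord_max].
Definition dinj r p := {f : {ffun 'I_r.+1 -> 'I_p.+1} | is_dinj f}.
Definition dval r p (f : dinj r p) (i : nat) : nat := val f (inord i).
Definition gaps r p (f : dinj r p) :=
  mkseq (fun i => dval f i.+1 - dval f i)%N r.

Section DinjTheory.
Local Open Scope nat_scope.

Lemma is_dinjP r p (f : {ffun 'I_r.+1 -> 'I_p.+1}) :
  reflect [/\ forall i j : 'I_r.+1, i < j -> f i < f j, f ord0 = 0 :> nat
            & f ord_max = p :> nat] (is_dinj f).
Proof.
apply: (iffP and3P) => [[/forallP h /eqP-> /eqP->]|[h h0 hp]]; split => //.
- by move=> i j; have /forallP/(_ j)/implyP := h i.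
- by apply/forallP=> i; apply/forallP=> j; apply/implyP/h.
- exact/eqP/val_inj.
- exact/eqP/val_inj.
Qed.

Lemma dvalE r p (f : dinj r p) (i : 'I_r.+1) : val f i = dval f i :> nat.
Proof. by rewrite /dval inord_val. Qed.

Lemma dval0 r p (f : dinj r p) : dval f 0 = 0.
Proof.
have [_ h _] := is_dinjP _ (valP f); rewrite /dval (_ : inord 0 = ord0) ?h//.
by apply: val_inj; rewrite /= inordK.
Qed.

Lemma dvalM r p (f : dinj r p) : dval f r = p.
Proof.
have [_ _ h] := is_dinjP _ (valP f); rewrite /dval (_ : inord r = ord_max) ?h//.
by apply: val_inj; rewrite /= inordK.
Qed.

Lemma dval_ltn r p (f : dinj r p) i j : i < j -> j <= r -> dval f i < dval f j.
Proof.
case/is_dinjP: (valP f) => h _ _ lij ljr; apply: h.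
by rewrite !inordK // ltnS ?(leq_trans (ltnW lij)).
Qed.

Lemma dval_leq r p (f : dinj r p) i j : i <= j -> j <= r -> dval f i <= dval f j.
Proof.
by rewrite leq_eqVlt => /orP[/eqP->//|] lij ljr; apply/ltnW/dval_ltn.
Qed.

Lemma dval_leqM r p (f : dinj r p) i : i <= r -> dval f i <= p.
Proof. by move=> ir; rewrite -{2}(dvalM f) dval_leq. Qed.

Lemma mk_dinj_subproof r p (g : nat -> nat) :
  (forall i j, i < j -> j <= r -> g i < g j) -> g 0 = 0 -> g r = p ->
  is_dinj [ffun i : 'I_r.+1 => inord (g i) : 'I_p.+1].
Proof.
move=> h g0 gr; have gle i : i <= r -> g i < p.+1.
  rewrite leq_eqVlt ltnS => /orP[/eqP->|/h]; first by rewrite gr.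
  by rewrite -gr => /(_ (leqnn r))/ltnW.
apply/is_dinjP; split=> [i j ij||]; rewrite !ffunE !inordK ?gle ?leq_ord//.
by apply: h; rewrite ?leq_ord.
Qed.

Definition mk_dinj r p (g : nat -> nat) h g0 gr : dinj r p :=
  exist (@is_dinj r p) _ (@mk_dinj_subproof r p g h g0 gr).

Lemma mk_dinjE r p g h g0 gr i : i <= r -> dval (@mk_dinj r p g h g0 gr) i = g i.
Proof.
move=> ir; rewrite /dval /= ffunE !inordK // ltnS.
move: ir; rewrite leq_eqVlt => /orP[/eqP->|/h]; first by rewrite gr.
by rewrite -gr => /(_ (leqnn r))/ltnW.
Qed.

Lemma dlow_subproof r pn p p0 (f : dinj (r + pn) (p + p0)) :
  forall i j, i < j -> j <= r -> dval f i < dval f j.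
Proof. by move=> i j ij jr; rewrite dval_ltn// (leq_trans jr)// leq_addr. Qed.

(* f_(<= r) and f_(> r). *)
Definition dlow r pn p p0 (f : dinj (r + pn) (p + p0)) (e : dval f r = p) :
  dinj r p := mk_dinj (dlow_subproof f) (dval0 f) e.

Lemma dhigh_subproof r pn p p0 (f : dinj (r + pn) (p + p0)) (e : dval f r = p) :
  [/\ forall i j, i < j -> j <= pn -> dval f (r + i) - p < dval f (r + j) - p,
      dval f (r + 0) - p = 0 & dval f (r + pn) - p = p0].
Proof.
split; rewrite ?addn0 ?e ?subnn// ?dvalM ?addKn// => i j ij jr.
rewrite ltn_sub2r// ?dval_ltn// ?ltn_add2l ?leq_add2l// -{1}e dval_ltn//.
  by rewrite -{1}[r]addn0 ltn_add2l (leq_ltn_trans _ ij).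
by rewrite leq_add2l.
Qed.

Definition dhigh r pn p p0 (f : dinj (r + pn) (p + p0)) (e : dval f r = p) :
    dinj pn p0 :=
  let: And3 h h0 h1 := dhigh_subproof e in mk_dinj h h0 h1.

Lemma dcomp_subproof t r p (f1 : dinj r p) (f2 : dinj t r) :
  is_dinj [ffun i => val f1 (val f2 i)].
Proof.
have [h1 h10 h1p] := is_dinjP _ (valP f1); have [h2 h20 h2p] := is_dinjP _ (valP f2).
apply/is_dinjP; split=> [i j ij||]; rewrite !ffunE; first exact/h1/h2.
  by rewrite (_ : val f2 ord0 = ord0) ?h10//; apply: val_inj.
by rewrite (_ : val f2 ord_max = ord_max) ?h1p//; apply: val_inj.
Qed.

Definition dcomp t r p (f1 : dinj r p) (f2 : dinj t r) : dinj t p :=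
  exist (@is_dinj t p) _ (dcomp_subproof f1 f2).

Lemma dcompE t r p (f1 : dinj r p) (f2 : dinj t r) i :
  dval (dcomp f1 f2) i = dval f1 (dval f2 i).
Proof. by rewrite /dval /= ffunE inord_val. Qed.

Definition gapsn (g : nat -> nat) i m := [seq g j.+1 - g j | j <- iota i m].

Lemma sumn_gapsn g i m : (forall j, i <= j < i + m -> g j <= g j.+1) ->
  sumn (gapsn g i m) = g (i + m) - g i /\ g i <= g (i + m).
Proof.
elim: m i => [|m IH] i h /=; first by rewrite addn0 subnn.
have hi : g i <= g i.+1 by apply: h; rewrite leqnn addnS ltnS leq_addr.
have [j /andP[ij jm]|-> lt] := IH i.+1; first by apply: h; rewrite (ltnW ij) -addSnnS.
rewrite addSnnS in lt *; split; last exact: leq_trans lt.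
by rewrite addnC addnBA// subnK.
Qed.

Lemma gapsE r p (f : dinj r p) : gaps f = gapsn (dval f) 0 r.
Proof. by []. Qed.

Lemma size_gaps r p (f : dinj r p) : size (gaps f) = r.
Proof. by rewrite size_mkseq. Qed.

Lemma sumn_gaps r p (f : dinj r p) : sumn (gaps f) = p.
Proof.
rewrite gapsE; have [|->] := @sumn_gapsn (dval f) 0 r; last by rewrite dvalM dval0 subn0.
by move=> j /andP[_ jr]; apply: dval_leq.
Qed.

Fixpoint regroup (hs gs : seq nat) : seq nat :=
  if hs is h :: hs' then sumn (take h gs) :: regroup hs' (drop h gs) else [::].

Lemma regroup_gapsn g h i m : (forall j, i <= j < i + m -> h j <= h j.+1) ->
    (forall j, h i <= j < h (i + m) -> g j <= g j.+1) ->
  regroup (gapsn h i m) (gapsn g (h i) (h (i + m) - h i)) =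
    gapsn (fun j => g (h j)) i m.
Proof.
elim: m i => [//|m IH] i hh hg /=.
have hi : h i <= h i.+1 by apply: hh; rewrite leqnn addnS ltnS leq_addr.
have [j /andP[ij jm]|_ him] := @sumn_gapsn h i.+1 m.
  by apply: hh; rewrite (ltnW ij) -addSnnS.
rewrite addSnnS in him.
rewrite /gapsn -map_take -map_drop take_iota drop_iota.
rewrite [h i + _]addnC (subnK hi) -subnDA [h i + (_ - _)]addnC (subnK hi).
rewrite (minn_idPl _) ?leq_sub2r//; congr cons.
  have [j|e _] := @sumn_gapsn g (h i) (h i.+1 - h i).
    rewrite [h i + _]addnC subnK// => /andP[ij ji].
    by apply: hg; rewrite ij (leq_trans ji).
  by rewrite [h i + _]addnC subnK// in e.
have := IH i.+1; rewrite addSnnS; apply=> j /andP[ij jm].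
- by apply: hh; rewrite (ltnW ij).
- by apply: hg; rewrite jm (leq_trans hi).
Qed.

Lemma gaps_dcomp t r p (f1 : dinj r p) (f2 : dinj t r) :
  gaps (dcomp f1 f2) = regroup (gaps f2) (gaps f1).
Proof.
rewrite [in RHS]gapsE -[gaps f1]/(gapsn _ _ r).
have := @regroup_gapsn (dval f1) (dval f2) 0 t; rewrite add0n dval0 dvalM subn0.
move=> ->; [|by move=> j /andP[_ jr]; apply: dval_leq..].
by apply: eq_map => j; rewrite !dcompE.
Qed.

Lemma gaps_split r pn p p0 (f : dinj (r + pn) (p + p0)) (e : dval f r = p) :
  gaps f = gaps (dlow e) ++ gaps (dhigh e).
Proof.
rewrite gapsE /gapsn iotaD map_cat add0n; congr cat.
  apply/eq_in_map => j; rewrite mem_iota add0n /= => jr.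
  by rewrite /dlow !mk_dinjE// ltnW.
rewrite -[X in iota X _]addn0 iotaDl -map_comp; apply/eq_in_map => j.
rewrite mem_iota add0n /= => jr; rewrite /dhigh; case: dhigh_subproof => h h0 h1.
rewrite !mk_dinjE// ?(ltnW jr)// addnS.
have le k : k <= pn -> p <= dval f (r + k).
  by move=> kpn; rewrite -{1}e dval_leq ?leq_addr ?leq_add2l.
by rewrite -addnS subnBA ?le ?(ltnW jr)// subnK ?le.
Qed.

Lemma gaps_id r (f : dinj r r) : gaps f = nseq r 1.
Proof.
have le i j : i + j <= r -> dval f i + j <= dval f (i + j).
  elim: j => [|j IH]; rewrite ?addn0// !addnS => ij.
  by apply: leq_ltn_trans (IH (ltnW ij)) _; apply: dval_ltn.
have E i : i <= r -> dval f i = i.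
  move=> ir; apply/eqP; rewrite eqn_leq; apply/andP; split.
    rewrite -(leq_add2r (r - i)).
    by have := le i (r - i); rewrite subnKC// dvalM; apply.
  by have := le 0 i; rewrite add0n dval0; apply.
apply: (@eq_from_nth _ 0); rewrite size_gaps ?size_nseq// => i ir.
by rewrite nth_mkseq// nth_nseq ir !E ?subSnn// ltnW.
Qed.

End DinjTheory.

Section SimplexTheory.
Variable U : smallCat.

Lemma slen_scut m V X (s : simplex V X) :
  let: existT _ (_, s') := @scut U m V X s in slen s' = (slen s - m)%N.
Proof.
elim: s m => [W|W Y Z u s IH] [|m] //=.
by have := IH m; case: (scut m s) => ? [].
Qed.

Lemma slen_sface gs V X (s : simplex V X) :
  sumn gs = slen s -> slen (@sface U gs V X s) = size gs.
Proof.
elim: gs V s => [|g gs IH] V s /= e; first by [].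
have := slen_scut g s; case: (scut g s) => W [v s'] /= e'.
by rewrite IH// e' -e addKn.
Qed.

Lemma scut0 V X (s : simplex V X) : @scut U 0 V X s = existT _ V (idarr V, s).
Proof. by case: s. Qed.

Lemma scut_add m m' V X (s : simplex V X) :
  scut (m + m') s = let: existT W (v, s') := @scut U m V X s in
                    let: existT Y (v', s'') := scut m' s' in
                    existT _ Y (comparr v' v, s'').
Proof.
elim: s m m' => [W|W Y Z u s IH] [|m] m' /=.
- by case: m' => [|m'] /=; rewrite compIl.
- by case: m' => [|m'] /=; rewrite compIl.
- case: m' => [|m'] /=; first by rewrite compIl.
  by case: (scut m' s) => ? [? ?]; rewrite compIr.
- rewrite IH; case: (scut m s) => ? [? ?]; case: (scut m' _) => ? [? ?].
  by rewrite compA.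
Qed.

Lemma scut_sface h gs V X (s : simplex V X) : (h <= size gs)%N ->
  scut h (sface gs s) = let: existT W (v, s') := @scut U (sumn (take h gs)) V X s in
                        existT _ W (v, sface (drop h gs) s').
Proof.
elim: h gs V s => [|h IH] gs V s.
  by rewrite take0 drop0 !scut0.
case: gs => // g gs; rewrite ltnS => hgs.
rewrite [take _ _]/= [sumn _]/= scut_add [sface _ _]/=.
case: (scut g s) => W [v s']; rewrite [LHS]/= IH//.
by case: (scut _ s') => ? [? ?].
Qed.

Lemma sface_regroup hs gs V X (s : simplex V X) : sumn hs = size gs ->
  sface (regroup hs gs) s = @sface U hs V X (sface gs s).
Proof.
elim: hs gs V s => [|h hs IH] gs V s /= e; first by case: gs e.
rewrite scut_sface -?e ?leq_addr//; case: (scut _ s) => W [v s'].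
by rewrite IH// size_drop -e addKn.
Qed.

Lemma sface1 V X (s : simplex V X) : @sface U (nseq (slen s) 1%N) V X s = s.
Proof.
elim: s => [//|W Y Z u s IH].
transitivity (scons (comparr (idarr Y) u) (sface (nseq (slen s) 1%N) s)).
  by case: s u {IH}.
by rewrite IH compIl.
Qed.

Lemma slen_ssplit m V X (s : simplex V X) :
  let: existT _ (s1, s2) := @ssplit U m V X s in
  slen s1 = minn m (slen s) /\ slen s2 = (slen s - m)%N.
Proof.
elim: s m => [W|W Y Z u s IH] [|m] //=; rewrite ?minn0 ?min0n//.
have := IH m; case: (ssplit m s) => ? [s1 s2] [/= -> ->].
by rewrite minnSS.
Qed.

Fixpoint scat V W X (s1 : simplex V W) : simplex W X -> @simplex U V X :=
  match s1 in simplex V W return simplex W X -> simplex V X with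
  | snil _ => id
  | scons _ _ _ u s1' => fun s2 => scons u (scat s1' s2)
  end.

Lemma ssplitK m V X (s : simplex V X) :
  let: existT W (s1, s2) := ssplit m s in s = scat s1 s2.
Proof.
elim: s m => [W|W Y Z u s IH] [|m] //=.
by have := IH m; case: (ssplit m s) => ? [? ?] /= <-.
Qed.

Lemma scut_scat g V W X (s1 : simplex V W) (s2 : simplex W X) :
  (g <= slen s1)%N ->
  scut g (scat s1 s2) = let: existT Y (v, s') := scut g s1 in
                        existT _ Y (v, scat s' s2).
Proof.
elim: s1 g s2 => [Y|Y Z T u s IH] [|g] s2 //=.
  by move=> _; case: s2.
by move=> gs; rewrite IH//; case: (scut g s) => ? [? ?].
Qed.

Lemma sface_scat gs1 gs2 V W X (s1 : simplex V W) (s2 : simplex W X) :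
  sumn gs1 = slen s1 ->
  sface (gs1 ++ gs2) (scat s1 s2) = scat (sface gs1 s1) (sface gs2 s2).
Proof.
elim: gs1 V s1 s2 => [|g gs1 IH] V s1 s2 /= e.
  by case: s1 e s2.
rewrite scut_scat -?e ?leq_addr//.
have := slen_scut g s1; case: (scut g s1) => Y [v s'] /= e'.
by rewrite IH// e' -e addKn.
Qed.

End SimplexTheory.

Section Multilinear.
Variables (k : comPzRingType) (O : Type) (H : O -> O -> lmodType k).

Lemma multilin_eq n a (N : O -> lmodType k) (F F' : forall c, mpath H n a c -> N c) :
  (forall c w, F c w = F' c w) -> multilin F -> multilin F'.
Proof.
move=> e; suff -> : F = F' by [].
by apply: functional_extensionality_dep => c; apply: functional_extensionality_dep.
Qed.

Lemma multilin0 n a (N : O -> lmodType k) :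
  multilin (fun c (_ : mpath H n a c) => 0 : N c).
Proof.
elim: n a => //= n IH a b; split=> [c w x u v|u]; last exact: IH.
by rewrite scaler0 addr0.
Qed.

Lemma multilinD n a (N : O -> lmodType k) (F F' : forall c, mpath H n a c -> N c) :
  multilin F -> multilin F' -> multilin (fun c w => F c w + F' c w).
Proof.
elim: n a F F' => //= n IH a F F' h h' b; split=> [c w x u v|u]; last first.
  by apply: IH; [apply: (h b).2|apply: (h' b).2].
by rewrite (h b).1 (h' b).1 scalerDr addrACA.
Qed.

Lemma multilin_comp n a (N N' : O -> lmodType k) (F : forall c, mpath H n a c -> N c)
    (g : forall c, N c -> N' c) :
  (forall c, linear (g c)) -> multilin F -> multilin (fun c w => g c (F c w)).
Proof.
move=> lg; elim: n a F => //= n IH a F h b; split=> [c w x u v|u]; last first.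
  by apply: IH; apply: (h b).2.
by rewrite (h b).1 lg.
Qed.

Lemma multilin_sum n a (N : O -> lmodType k) (I : Type) (r : seq I)
    (F : I -> forall c, mpath H n a c -> N c) :
  (forall i, multilin (F i)) -> multilin (fun c w => \sum_(i <- r) F i c w).
Proof.
move=> h; elim: r => [|i r IH].
  apply: multilin_eq (multilin0 n a N) => c w; exact/esym/big_nil.
by apply: multilin_eq (multilinD (h i) IH) => c w; exact/esym/big_cons.
Qed.

Lemma multilin_split m n a (M N : O -> lmodType k)
    (th : forall b, mpath H m a b -> M b)
    (L : forall b, M b -> forall c, mpath H n b c -> N c) :
  multilin th -> (forall b c w, linear (fun u => L b u c w)) ->
  (forall b u, multilin (L b u)) ->
  multilin (fun c (w : mpath H (m + n) a c) =>
    let: existT b (w1, w2) := msplit w in L b (th b w1) c w2).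
Proof.
move=> hth hL1 hL2; elim: m a th hth => [|m IH] a th hth; first exact: hL2.
move=> b; split=> [c w x u v|u] /=.
  case: (msplit w) => d [w1 w2].
  by rewrite (hth b).1 hL1.
apply: multilin_eq (IH b (fun c w => th c (pcons u w)) ((hth b).2 u)) => c w /=.
by case: (msplit w) => d [].
Qed.

End Multilinear.

Section FaceTheory.
Variables (k : comPzRingType) (U : smallCat) (A : quiverOn k U).

Lemma face_subproof r p V X (f : dinj r p) (s : @psimplex U p V X) :
  slen (sface (gaps f) (val s)) == r.
Proof.
by case: s => s /= /eqP e; rewrite slen_sface ?size_gaps// sumn_gaps e.
Qed.

(* The r-simplex f(sigma). *)
Definition face r p V X (f : dinj r p) (s : @psimplex U p V X) : psimplex r V X :=
  exist _ (sface (gaps f) (val s)) (face_subproof f s).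

Lemma face_id p V X (f : dinj p p) (s : @psimplex U p V X) : face f s = s.
Proof.
apply: val_inj; case: s => s /= /eqP e.
by rewrite gaps_id -e sface1.
Qed.

Lemma face_dcomp t r p V X (f1 : dinj r p) (f2 : dinj t r) (s : @psimplex U p V X) :
  face f2 (face f1 s) = face (dcomp f1 f2) s.
Proof.
by apply: val_inj; rewrite /= gaps_dcomp sface_regroup// sumn_gaps size_gaps.
Qed.

Record splitting p p0 V X (s : @psimplex U (p + p0) V X) := Splitting {
  mid : obj U;
  slow : psimplex p V mid;
  shigh : psimplex p0 mid X;
  splittingE : val s = scat (val slow) (val shigh) }.

(* sigma_(<= p) and sigma_(> p). *)
Definition psplit p p0 V X (s : @psimplex U (p + p0) V X) : splitting s.
Proof.
have := slen_ssplit p (val s); have := ssplitK p (val s).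
case: (ssplit p (val s)) => W [s1 s2] e.
rewrite (eqP (valP s)) (minn_idPl (leq_addr _ _)) addKn => -[/eqP e1 /eqP e2].
exact: (@Splitting _ _ _ _ _ W (exist _ s1 e1) (exist _ s2 e2)).
Defined.

Definition pull p V X (s : @psimplex U p V X) : A X -> A V := spull A (val s).

Lemma spull_scat V W X (s1 : simplex V W) (s2 : simplex W X) a :
  spull A (scat s1 s2) a = spull A s1 (spull A s2 a).
Proof. by elim: s1 s2 => //= ? ? ? u s1 IH s2; rewrite IH. Qed.

Lemma pull_split p p0 V X (s : @psimplex U (p + p0) V X) a :
  pull (slow (psplit s)) (pull (shigh (psplit s)) a) = pull s a.
Proof. by rewrite /pull (splittingE (psplit s)) spull_scat. Qed.

Lemma pull_face_split p p0 r pn V X (s : @psimplex U (p + p0) V X)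
    (f : dinj (r + pn) (p + p0)) (e : dval f r = p) a :
  pull (face (dlow e) (slow (psplit s))) (pull (face (dhigh e) (shigh (psplit s))) a)
    = pull (face f s) a.
Proof.
rewrite /pull /= (gaps_split e) [in RHS](splittingE (psplit s)).
rewrite sface_scat ?spull_scat// sumn_gaps.
by rewrite (eqP (valP (slow (psplit s)))).
Qed.

End FaceTheory.
Arguments pull {k U} A {p V X}.

Section Cochains.
Variables (k : comPzRingType) (U : smallCat) (A : quiverOn k U).

Definition cotarget r p V X (s : psimplex p V X) (f : dinj r p) (a b : A X) :
  lmodType k := @qhom k (A V) (pull A s a) (pull A (face f s) b).

(* C_□^(p,q,r)(A).  It vanishes for p < r, as [dinj r p] is then empty. *)
Record cochain (c : colour) := Cochain {
  cofun : forall V X (s : psimplex c.1.1 V X) (f : dinj c.2 c.1.1) (a b : A X),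
    mpath (@qhom k (A X)) c.1.2 a b -> cotarget s f a b;
  cofun_multilin : forall V X (s : psimplex c.1.1 V X) (f : dinj c.2 c.1.1) (a : A X),
    @multilin k (A X) (@qhom k (A X)) c.1.2 a (cotarget s f a) (@cofun V X s f a) }.

Variable c : colour.

Lemma cochainP (x y : cochain c) :
  (forall V X s f a b w, @cofun c x V X s f a b w = cofun y s f w) -> x = y.
Proof.
case: x y => x hx [y hy] /= e; have exy : x = y.
  by do 7!(apply: functional_extensionality_dep => ?); apply: e.
by rewrite exy in hx *; rewrite (Prop_irrelevance hx hy).
Qed.

HB.instance Definition _ := gen_eqMixin (cochain c).
HB.instance Definition _ := gen_choiceMixin (cochain c).

Definition cochain0 : cochain c :=
  @Cochain c (fun _ _ _ _ _ _ _ => 0)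
    (fun V X s f a => @multilin0 k _ (@qhom k _) _ a (cotarget s f a)).
Definition cochainD (x y : cochain c) : cochain c :=
  @Cochain c (fun _ _ s f _ _ w => cofun x s f w + cofun y s f w)
    (fun _ _ s f a => multilinD (cofun_multilin x s f a) (cofun_multilin y s f a)).

Lemma scale_linear (M : lmodType k) (l : k) : linear (fun u : M => l *: u).
Proof. by move=> x u v; rewrite scalerDr !scalerA mulrC. Qed.

Definition cochainZ (l : k) (x : cochain c) : cochain c :=
  @Cochain c (fun _ _ s f _ _ w => l *: cofun x s f w)
    (fun _ _ s f a => multilin_comp
       (g := fun b (u : cotarget s f a b) => l *: u)
       (fun b => @scale_linear _ l) (cofun_multilin x s f a)).

Definition cochainN x := cochainZ (-1) x.

Lemma cochain_addA : associative cochainD.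
Proof. by move=> x y z; apply: cochainP => * /=; rewrite addrA. Qed.
Lemma cochain_addC : commutative cochainD.
Proof. by move=> x y; apply: cochainP => * /=; rewrite addrC. Qed.
Lemma cochain_add0 : left_id cochain0 cochainD.
Proof. by move=> x; apply: cochainP => * /=; rewrite add0r. Qed.
Lemma cochain_addN : left_inverse cochain0 cochainN cochainD.
Proof. by move=> x; apply: cochainP => * /=; rewrite scaleN1r addNr. Qed.

HB.instance Definition _ := GRing.isZmodule.Build (cochain c)
  cochain_addA cochain_addC cochain_add0 cochain_addN.

Lemma cochain_scaleA l l' x : cochainZ l (cochainZ l' x) = cochainZ (l * l') x.
Proof. by apply: cochainP => * /=; rewrite scalerA. Qed.
Lemma cochain_scale1 : left_id 1 cochainZ.
Proof. by move=> x; apply: cochainP => * /=; rewrite scale1r. Qed.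
Lemma cochain_scaleDr : right_distributive cochainZ +%R.
Proof. by move=> l x y; apply: cochainP => * /=; rewrite scalerDr. Qed.
Lemma cochain_scaleDl x : {morph cochainZ^~ x : l l' / l + l'}.
Proof. by move=> l l'; apply: cochainP => * /=; rewrite scalerDl. Qed.

HB.instance Definition _ := GRing.Zmodule_isLmodule.Build k (cochain c)
  cochain_scaleA cochain_scale1 cochain_scaleDr cochain_scaleDl.

End Cochains.

Section CochainOperations.
Variables (k : comPzRingType) (U : smallCat) (A : quiverOn k U).
Local Notation C := (cochain A).
Local Notation H V := (@qhom k (A V)).

Lemma mpath0 O (Q : O -> O -> Type) a b : mpath Q 0 a b -> a = b.
Proof. by move=> w; inversion w. Qed.

Definition arrow1 O (Q : O -> O -> Type) a b (w : mpath Q 1 a b) : Q a b :=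
  match w in mpath _ n a b return n = 1%N -> Q a b with
  | pnil _ => fun e => False_rect _ (O_S _ e)
  | pcons n a c b u w' => fun e =>
      ecast x (Q a x) (mpath0 (ecast i (mpath Q i c b) (congr1 predn e) w')) u
  end erefl.

Definition hcast V (a a' b b' : A V) (ea : a = a') (eb : b = b') (u : H V a b) :
  H V a' b' := ecast y (H V a' y) eb (ecast x (H V x b) ea u).

Lemma hcast_linear V (a a' b b' : A V) (ea : a = a') (eb : b = b') :
  linear (hcast ea eb).
Proof. by case: _ / ea; case: _ / eb. Qed.

Lemma face_id_end p V X (f : dinj p p) (s : psimplex p V X) (a b : A X) :
  a = b -> pull A s a = pull A (face f s) b.
Proof. by rewrite face_id => ->. Qed.

Lemma face_dcomp_end t r p V X (f1 : dinj r p) (f2 : dinj t r) (f : dinj t p)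
  (s : psimplex p V X) (b : A X) : dcomp f1 f2 = f ->
  pull A (face f2 (face f1 s)) b = pull A (face f s) b.
Proof. by rewrite face_dcomp => ->. Qed.

(* (th_1 (x)_A .. (x)_A th_n)^(sigma,f) evaluated at composable arrows, as a formal sum
   of elementary tensors in n composable arrows of A(V).  Endpoints are transported
   along f_2(f_1(sigma)) = (f_1 o f_2)(sigma). *)
Fixpoint tens p0 l (ths : chain C p0 l) V X (s : psimplex p0 V X)
    (f : dinj (clast p0 l) p0) (a b : A X) :
    mpath (H X) (cqs l) a b ->
    seq (mpath (H V) (size l) (pull A s a) (pull A (face f s) b)) :=
  match ths in chain _ p0 l return
    forall (s : psimplex p0 V X) (f : dinj (clast p0 l) p0),
    mpath (H X) (cqs l) a b ->
    seq (mpath (H V) (size l) (pull A s a) (pull A (face f s) b)) with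
  | cnil p0 => fun s f w =>
      [:: mend (face_id_end f s (mpath0 w)) (pnil (pull A s a))]
  | ccons p0 q p1 l th ths' => fun s f w =>
      let: existT m (w1, w2) := msplit (m := q) (n := cqs l) w in
      flatten [seq flatten [seq
        match dcomp f1 f2 =P f with
        | ReflectT e =>
            [seq pcons (cofun th s f1 w1) (mend (face_dcomp_end s b e) v)
               | v <- tens ths' (face f1 s) f2 w2]
        | ReflectF _ => [::]
        end | f2 <- enum {: dinj (clast p1 l) p1}] | f1 <- enum {: dinj p1 p0}]
  end s f.

Lemma tens_multilin p0 l (ths : chain C p0 l) V X (s : psimplex p0 V X)
    (f : dinj (clast p0 l) p0) (a : A X) (N : A V -> lmodType k)
    (G : forall b, mpath (H V) (size l) (pull A s a) b -> N b) :
  multilin G ->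
  @multilin k _ (H X) _ a (fun b => N (pull A (face f s) b))
    (fun b w => \sum_(v <- tens ths s f w) G _ v).
Proof.
elim: ths s f a N G => [{}p0|{}p0 q p1 {}l th ths IH] s f a N G hG //.
pose K f1 f2 m (u : H V (pull A s a) (pull A (face f1 s) m)) b
    (w2 : mpath (H X) (cqs l) m b) : N (pull A (face f s) b) :=
  match dcomp f1 f2 =P f with
  | ReflectT e => \sum_(v <- tens ths (face f1 s) f2 w2)
                    G _ (pcons u (mend (face_dcomp_end s b e) v))
  | ReflectF _ => 0
  end.
apply: (@multilin_eq k _ (H X) _ _ _ (fun b w =>
    \sum_(f1 <- enum {: dinj p1 p0}) \sum_(f2 <- enum {: dinj (clast p1 l) p1})
      let: existT m (w1, w2) := msplit w in K f1 f2 m (cofun th s f1 w1) b w2)).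
  move=> b w /=; case: (msplit w) => m [w1 w2].
  rewrite big_flatten big_map; apply: eq_bigr => f1 _.
  rewrite big_flatten big_map; apply: eq_bigr => f2 _.
  by rewrite /K; case: eqP => e; rewrite ?big_map ?big_nil.
apply: multilin_sum => f1; apply: multilin_sum => f2.
apply: (@multilin_split k _ (H X) q (cqs l) a
  (fun b => H V (pull A s a) (pull A (face f1 s) b))
  (fun b => N (pull A (face f s) b)) (fun b w1 => cofun th s f1 w1) (K f1 f2)).
- exact: (cofun_multilin th s f1 a).
- move=> m b w2 x u v; rewrite /K; case: eqP => e; last by rewrite scaler0 addr0.
  rewrite scaler_sumr -big_split; apply: eq_bigr => y _.
  exact: (hG _).1.
- move=> m u; rewrite /K; case: eqP => [e|_]; last exact: multilin0.
  have E : face f2 (face f1 s) = face f s by rewrite face_dcomp e.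
  suff gen tau (E' : face f2 (face f1 s) = tau)
      (eb : forall b : A X, pull A (face f2 (face f1 s)) b = pull A tau b) :
      @multilin k _ (H X) (cqs l) m (fun b => N (pull A tau b)) (fun b w =>
        \sum_(v <- tens ths (face f1 s) f2 w) G _ (pcons u (mend (eb b) v))).
    exact: (gen _ E (fun b => face_dcomp_end s b e)).
  case: _ / E' in eb *; apply: multilin_eq (IH _ f2 m N _ ((hG _).2 u)) => b w /=.
  by apply: eq_bigr => v _; rewrite (Prop_irrelevance (eb b) erefl).
Qed.

(* Endpoints are transported along sigma^* = sigma_(<= p)^* sigma_(> p)^* and
   f(sigma)^* = f_(<= r)(sigma_(<= p))^* f_(> r)(sigma_(> p))^*. *)
Definition comp_fun p m r p0 l (x : C (p, m, r)) (ths : chain C p0 l)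
    (e : size l = m) V X (s : psimplex (p + p0) V X)
    (f : dinj (r + clast p0 l) (p + p0)) (a b : A X) (w : mpath (H X) (cqs l) a b) :
    cotarget s f a b :=
  match dval f r =P p with
  | ReflectT ef =>
      hcast (pull_split s a) (pull_face_split s ef b)
        (\sum_(v <- tens ths (shigh (psplit s)) (dhigh ef) w)
           cofun x (slow (psplit s)) (dlow ef) (ecast i (mpath (H _) i _ _) e v))
  | ReflectF _ => 0
  end.

Lemma comp_multilin p m r p0 l (x : C (p, m, r)) (ths : chain C p0 l)
  (e : size l = m) V X (s : psimplex (p + p0) V X)
  (f : dinj (r + clast p0 l) (p + p0)) (a : A X) :
  @multilin k _ (H X) (cqs l) a (cotarget s f a) (@comp_fun _ _ _ _ _ x ths e V X s f a).
Proof.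
case: m / e x => x; rewrite /comp_fun; case: eqP => [ef|_]; last exact: multilin0.
apply: (multilin_comp (g := fun b => hcast (pull_split s a) (pull_face_split s ef b))).
  by move=> b; apply: hcast_linear.
exact: tens_multilin (cofun_multilin x _ _ _).
Qed.

Definition cochain_comp p m r p0 l (x : C (p, m, r)) (ths : chain C p0 l)
    (e : size l = m) : C (mu_colour p r p0 l) :=
  @Cochain k U A (mu_colour p r p0 l) (comp_fun x ths e) (comp_multilin x ths e).

Definition unit_fun V X (s : psimplex 0 V X) (f : dinj 0 0) (a b : A X)
    (w : mpath (H X) 1 a b) : cotarget s f a b :=
  match s with
  | exist s' h =>
    match s' as s' in simplex V X return forall (h : slen s' == 0%N) (a b : A X),
      mpath (H X) 1 a b -> cotarget (exist _ s' h) f a b with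
    | snil V => fun h a b w => arrow1 w
    | scons _ _ _ _ _ => fun h => False_rect _ (notF h)
    end h a b w
  end.

Lemma unit_multilin V X (s : psimplex 0 V X) (f : dinj 0 0) (a : A X) :
  @multilin k _ (H X) 1 a (cotarget s f a) (@unit_fun V X s f a).
Proof.
case: s => s h b; split=> // c w x u v; move: h f a u v.
case: s b c w => // Y b c w h f a u v.
exact: (hcast_linear erefl (mpath0 w)).
Qed.

Definition cochain_unit : C (0, 1, 0)%N :=
  @Cochain k U A (0, 1, 0)%N unit_fun unit_multilin.

End CochainOperations.

Section GerstenhaberSchack.
Variables (k : comPzRingType) (U : smallCat) (A : quiverOn k U).

Definition cochain_box : box_structure k :=
  @BoxStructure k (fun c => cochain A c) (@cochain_comp k U A) (cochain_unit A).

Definition gs_box (p q : nat) : colour := (p, q, if p is 0 then 0 else 1)%N.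

Definition CGSpq (p q : nat) : lmodType k := cochain_box (gs_box p q).

(* The sum over p + q = n is finite, so it is the product. *)
Definition CGS (n : int) := forall p q : nat, p%:Z + q%:Z = n -> CGSpq p q.

(* The degree d part of s^-1 C_GS(A): the elements of [CGS (d + 1)], extended by zero.
   Note that td (gs_box p q) = p + q - 1. *)
Definition sCGS (d : int) (x : Tot cochain_box d) : Prop :=
  exists y : CGS (d + 1),
    (forall p q (e : p%:Z + q%:Z = d + 1) (e' : td (gs_box p q) = d),
       x (gs_box p q) e' = y p q e) /\
    (forall c (e : td c = d), (forall p q, c <> gs_box p q) -> x c e = 0).

End GerstenhaberSchack.

(* Main.v *)
Require Import Defs.
From mathcomp Require Import all_boot all_order all_algebra.
From mathcomp Require Import boolp classical_sets fsbigop.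
From mathcomp Require Import zify.

Set Implicit Arguments.
Unset Strict Implicit.
Unset Printing Implicit Defensive.

Import GRing.Theory.
Local Open Scope ring_scope.

(** A cochain of Tot lies in s^-1 C_GS when it is supported on the colours
    (0, q, 0) and (p, q, 1) with p > 0 ([sCGSP]).  Closure under P_n already holds
    stacking by stacking: the operation of a thin-quadratic S of output colour c
    vanishes on such cochains unless c is again one of these colours.

    First, if some box of S is not of that form, the corresponding argument is zero,
    and so is the value of S, which is multilinear ([eval_zero]).

    Otherwise all boxes of S are thin or of the form (p, q, 1) with p > 0, and c is
    determined by counting ([thin_quadratic_output]).
    - The degree d = p - r + q - 1 of the output is the sum of the degrees of the boxes
      ([dd_boxes]), and td exceeds d by one on the colours that are not thin.  So
      |S^td| is minus the number of boxes that are not thin, plus one if c is not thin.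
      Equating it to 2 - n leaves two thin boxes if c is thin and a single one
      otherwise ([card_thin_inputs]).
    - In the horizontal composite graph each vertex has at most one output, so
      following the wires downstream leads from any vertex that has an output to a
      well-defined global output.  This labels the wires by global outputs, and the
      label is constant on connected components.  Each global output therefore has a
      component of its own, and each thin box is an isolated vertex: there are at least
      r + #(thin boxes) components ([ncomponents_ge]).
    Hence if c = (p, q, r) is not thin, two components and one thin box leave r <= 1.
    As the boxes have inputs exactly when they have outputs, so does S
    ([inputless_outputless]); thus r = 1 and p > 0.  If c is thin, it is of the form
    (0, q, 0) by definition. *)

(** * Induction on terms *)

(** The chain argument of [mu] nests [term] inside [chain]; the generated induction
    principle gives no hypothesis for the entries of the chain. *)
Section TermInduction.
Variables (n : nat) (G : {ffun 'I_n -> colour}).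
Variables (Q : forall p0 l, chain (term G) p0 l -> Prop)
  (P : forall c, term G c -> Prop).
Hypotheses
  (Pvar : forall i c (e : G i = c), P (var e))
  (Peta : P (eta G))
  (Pmu : forall p m r p0 l (x : term G (p, m, r)) (ys : chain (term G) p0 l)
    (e : size l = m), P x -> Q ys -> P (mu x ys e))
  (Qnil : forall p0, Q (cnil p0))
  (Qcons : forall p0 q p1 l (y : term G (p0, q, p1)) (ys : chain (term G) p1 l),
    P y -> Q ys -> Q (ccons y ys)).

Fixpoint term_chain_ind c (t : term G c) : P t :=
  match t with
  | var _ _ e => Pvar e
  | eta => Peta
  | mu _ _ _ _ _ x ys e =>
      let fix chain_ind p0 l (ys : chain (term G) p0 l) : Q ys :=
        match ys with
        | cnil p0 => Qnil p0
        | ccons _ _ _ _ y ys' => Qcons (term_chain_ind y) (chain_ind _ _ ys')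
        end in
      Pmu e (term_chain_ind x) (chain_ind _ _ ys)
  end.

End TermInduction.

(** * Colours of terms *)

Section Terms.
Variables (n : nat) (G : {ffun 'I_n -> colour}).

Local Notation cboxes := (cfold (fun=> [::]) (@boxes n G) cat).
Local Notation chgraph :=
  (cfold (fun p0 => [seq (inl j, inl j) | j <- iota 0 p0]) (@hgraph n G) (@serial n)).

(** In mu(x; y_1, .., y_m) the m of q(x) is used up by the -1 in the degrees of the
    y_i, and the differences p_(i-1) - p_i telescope. *)
Lemma dd_boxes c (t : term G c) : dd c = \sum_(i <- boxes t) dd (G i).
Proof.
elim/(@term_chain_ind n G (fun p0 l ys =>
  p0%:Z - (clast p0 l)%:Z + (cqs l)%:Z - (size l)%:Z
    = \sum_(i <- cboxes ys) dd (G i))): c / t.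
- by move=> i c e; rewrite /= big_seq1 e.
- by rewrite big_nil.
- move=> p m r p0 l x ys e /= ex eys; rewrite big_cat /= -ex -eys; lia.
- by move=> p0; rewrite big_nil /clast /cqs /=; lia.
- move=> p0 q p1 l y ys /= ey eys; rewrite big_cat /= -ey -eys /clast /cqs /=; lia.
Qed.

(** In a chain, p_(i-1) = 0 if and only if p_i = 0, so this propagates from p_0 to
    p_n. *)
Lemma inputless_outputless c (t : term G c) :
  (forall i, ((G i).1.1 == 0%N) = ((G i).2 == 0%N)) -> (c.1.1 == 0%N) = (c.2 == 0%N).
Proof.
move=> hG; elim/(@term_chain_ind n G (fun p0 l ys =>
  (p0 == 0%N) = (clast p0 l == 0%N))): c / t => //.
- by move=> i c e; rewrite -e.
- by move=> p m r p0 l x ys e /= ex eys; rewrite !addn_eq0 ex eys.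
- by move=> p0 q p1 l y ys /= ->.
Qed.

(** * Wires of the horizontal composite graph *)

Definition touches (w : wiring n) (i : 'I_n) :=
  has (fun a => at_box i a.1 || at_box i a.2) w.

Lemma touches_juxtapose p r (w w' : wiring n) i :
  touches (juxtapose p r w w') i = touches w i || touches w' i.
Proof.
rewrite /touches has_cat has_map; congr orb; apply: eq_has => -[a b] /=.
by case: a b => [?|?] [?|?].
Qed.

Lemma touches_serial (w w' : wiring n) i :
  touches (serial w w') i -> touches w i || touches w' i.
Proof.
case/hasP => a; rewrite !mem_cat !mem_filter => /or3P[/andP[_ aw]|/andP[_ aw]|] ta.
- by apply/orP; left; apply/hasP; exists a.
- by apply/orP; right; apply/hasP; exists a.
- case/flattenP: ta => s /mapP[b bw ->] /mapP[b'].
  rewrite mem_filter => /andP[_ bw'] -> /= /orP[h|h]; apply/orP; [left|right].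
    by apply/hasP; exists b => //; rewrite h.
  by apply/hasP; exists b' => //; rewrite h orbT.
Qed.

(** A thin box has no ports, so it is isolated in every composite. *)
Lemma touches_hgraph c (t : term G c) i :
  touches (hgraph t) i -> (i \in boxes t) && ~~ thin (G i).
Proof.
elim/(@term_chain_ind n G (fun p0 l ys =>
  touches (chgraph ys) i -> (i \in cboxes ys) && ~~ thin (G i))): c / t => //.
- move=> i' c e; rewrite /= /vertex /touches has_cat !has_map mem_seq1 /thin.
  case/orP => /hasP[j]; rewrite mem_iota /= ?orbF => h /eqP <-;
    by rewrite eqxx; lia.
- move=> p m r p0 l x ys e /= hx hys; rewrite touches_juxtapose mem_cat.
  by case/orP => [/hx|/hys] /andP[-> ->]; rewrite ?orbT.
- by move=> p0; case/hasP => a /mapP[j _ ->].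
- move=> p0 q p1 l y ys /= hy hys /touches_serial; rewrite mem_cat.
  by case/orP => [/hy|/hys] /andP[-> ->]; rewrite ?orbT.
Qed.

(** * Downstream labelling of the wires *)

Definition label (h : nat -> nat) (g : 'I_n -> nat) (a : port n) : nat :=
  match a with inl j => h j | inr (i, _) => g i end.

(** [h j] is the global output reached from the global input [j], and [g i] the one
    reached from the vertex [i].  Global targets are labelled by themselves, so
    [drains_label] says that a label is unchanged along a wire.  The bound on inputs
    tells the inputs of the two sides of a juxtaposition apart, and ensures in a serial
    composite that each input of the second graph is an output of the first. *)
Record drains (w : wiring n) (p r : nat) (h : nat -> nat) (g : 'I_n -> nat) : Prop :=
  Drains {
    drains_label : forall s t, (s, t) \in w -> label h g s = label id g t;
    drains_input : forall j t, (inl j, t) \in w -> (j < p)%N;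
    drains_output : forall j, (j < r)%N -> exists s, (s, inl j) \in w }.

Lemma touches_src (w : wiring n) i k t : (inr (i, k), t) \in w -> touches w i.
Proof. by move=> h; apply/hasP; exists (inr (i, k), t); rewrite //= eqxx. Qed.

Lemma touches_tgt (w : wiring n) i k s : (s, inr (i, k)) \in w -> touches w i.
Proof. by move=> h; apply/hasP; exists (s, inr (i, k)); rewrite //= eqxx orbT. Qed.

(** With at most one output, all inputs of the vertex can be sent to output 0. *)
Lemma drains_vertex i : ((G i).2 <= 1)%N ->
  drains (vertex G i) (G i).1.1 (G i).2 (fun=> 0%N) (fun=> 0%N).
Proof.
move=> r1; split=> [s t|j t|j jr].
- rewrite mem_cat => /orP[] /mapP[j]; rewrite mem_iota => hj [-> ->] //=; lia.
- by rewrite mem_cat => /orP[] /mapP[j']; rewrite mem_iota => hj [] // ->.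
- exists (inr (i, j)); rewrite mem_cat; apply/orP; right.
  by apply/mapP; exists j; rewrite ?mem_iota.
Qed.

Lemma drains_wires p :
  drains [seq (inl j, inl j) | j <- iota 0 p] p p id (fun=> 0%N).
Proof.
split=> [s t|j t|j jr].
- by case/mapP => j _ [-> ->].
- by case/mapP => j'; rewrite mem_iota => hj [-> _].
- by exists (inl j); apply/mapP; exists j; rewrite ?mem_iota.
Qed.

(** The two labellings of vertices can be merged because no vertex occurs on both
    sides; this is where linearity of terms enters. *)
Lemma drains_juxtapose p r p' r' (w w' : wiring n) h g h' g' :
  drains w p r h g -> drains w' p' r' h' g' ->
  (forall i, touches w i -> ~~ touches w' i) ->
  drains (juxtapose p r w w') (p + p') (r + r')
    (fun j => if (j < p)%N then h j else r + h' (j - p))%N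
    (fun i => if touches w i then g i else r + g' i)%N.
Proof.
move=> [l1 i1 o1] [l2 i2 o2] dis; have dis' i : touches w' i -> touches w i = false.
  by move=> ti; apply/negP => /dis; rewrite ti.
split=> [s t|j t|j jr].
- rewrite mem_cat => /orP[st|/mapP[[a b] ab /= [-> ->]]].
    case: s st => [j|[i k]] st; case: t st => [j'|[i' k']] st; move: (l1 _ _ st) => /=;
      by rewrite ?(touches_src st) ?(touches_tgt st) ?(i1 _ _ st).
  have shift j : (p + j < p)%N = false by lia.
  case: a ab => [j|[i k]] ab; case: b ab => [j'|[i' k']] ab; move: (l2 _ _ ab) => /=;
    by rewrite ?(dis' _ (touches_src ab)) ?(dis' _ (touches_tgt ab)) ?shift ?addKn => ->.
- rewrite mem_cat => /orP[/i1|/mapP[[[j'|?] b] ab /= []//]]; first by lia.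
  by move=> -> _; rewrite ltn_add2l (i2 _ _ ab).
- have [jr'|jr'] := ltnP j r.
    by have [s sj] := o1 j jr'; exists s; rewrite mem_cat sj.
  have [|s sj] := o2 (j - r)%N; first by lia.
  (* In the juxtaposition the global inputs of [w'] are numbered from [p] on. *)
  exists (if s is inl k then inl (p + k)%N else s); rewrite mem_cat; apply/orP; right.
  by apply/mapP; exists (s, inl (j - r)%N) => //=; rewrite subnKC.
Qed.

(** What drains to output [k] of [w] continues to the output [h' k] of [w']. *)
Lemma drains_serial p q r (w w' : wiring n) h g h' g' :
  drains w p q h g -> drains w' q r h' g' ->
  (forall i, touches w i -> ~~ touches w' i) ->
  drains (serial w w') p r (h' \o h) (fun i => if touches w i then h' (g i) else g' i).
Proof.
move=> [l1 i1 o1] [l2 i2 o2] dis; have dis' i : touches w' i -> touches w i = false.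
  by move=> ti; apply/negP => /dis; rewrite ti.
pose g'' i := if touches w i then h' (g i) else g' i.
have src s t : (s, t) \in w -> label (h' \o h) g'' s = h' (label id g t).
  move=> st; rewrite -(l1 _ _ st).
  by case: s st => [j|[i k]] //= /touches_src; rewrite /g'' => ->.
have tgt s t : (s, t) \in w' -> label id g'' t = label h' g' s.
  move=> st; rewrite (l2 _ _ st).
  by case: t st => [j|[i k]] //= /touches_tgt/dis'; rewrite /g'' => ->.
split=> [s t|j t|j jr].
- rewrite !mem_cat !mem_filter => /or3P[/andP[/= et st]|/andP[/= es st]|].
  + rewrite (src _ _ st); case: t et st => [//|[i k]] _ /touches_tgt /= ti.
    by rewrite /g'' ti.
  + rewrite (tgt _ _ st); case: s es st => [//|[i k]] _ /touches_src/dis' /= ti.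
    by rewrite /g'' ti.
  + case/flattenP => _ /mapP[[s' b] sb ->] /mapP[[b' t']].
    rewrite mem_filter /= => /andP[/andP[eb /eqP e] bt] [-> ->].
    by rewrite (src _ _ sb) (tgt _ _ bt) e; case: b {sb} e eb => [//|?] ->.
- rewrite !mem_cat !mem_filter => /or3P[/andP[_ /i1]//|/andP[]//|].
  by case/flattenP => _ /mapP[[s' b] sb ->] /mapP[b' _ [e _]]; apply: (i1 j b); rewrite e.
(* Output [j] is fed in [w'] by a vertex, or by a global input [k], which is then an
   output of [w]. *)
- have [[k|a] sj] := o2 j jr; last first.
    by exists (inr a); rewrite !mem_cat !mem_filter sj.
  have [s sk] := o1 k (i2 _ _ sj); exists s; rewrite !mem_cat; apply/orP; right.
  apply/orP; right; apply/flattenP; exists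
    [seq (s, a'.2) | a' <- w' & external a'.1 && (a'.1 == inl k)].
    by apply/mapP; exists (s, inl k).
  by apply/mapP; exists (inl k, inl j); rewrite // mem_filter sj /= eqxx.
Qed.

Lemma touches_chgraph p0 l (ys : chain (term G) p0 l) i :
  touches (chgraph ys) i -> (i \in cboxes ys) && ~~ thin (G i).
Proof.
elim: ys => [{}p0|{}p0 q p1 {}l y ys IH] /=; first by case/hasP => a /mapP[j _ ->].
move/touches_serial; rewrite mem_cat.
by case/orP => [/touches_hgraph|/IH] /andP[-> ->]; rewrite ?orbT.
Qed.

Lemma drains_hgraph c (t : term G c) :
  uniq (boxes t) -> (forall i, (G i).2 <= 1)%N ->
  exists h g, drains (hgraph t) c.1.1 c.2 h g.
Proof.
move=> + r1.
elim/(@term_chain_ind n G (fun p0 l ys => uniq (cboxes ys) ->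
  exists h g, drains (chgraph ys) p0 (clast p0 l) h g)): c / t.
- move=> i c e _; rewrite /= -e; do 2!eexists; exact: drains_vertex.
- by move=> _; exists id, (fun=> 0%N).
- move=> p m r p0 l x ys e hx hys.
  rewrite /= cat_uniq => /and3P[/hx[h [g d]] /hasPn dis /hys[h' [g' d']]].
  do 2!eexists; apply: drains_juxtapose d d' _ => i /touches_hgraph/andP[ix _].
  by apply/negP => /touches_chgraph/andP[/dis]; rewrite ix.
- by move=> p0 _; do 2!eexists; exact: drains_wires.
- move=> p0 q p1 l y ys hy hys.
  rewrite /= cat_uniq => /and3P[/hy[h [g d]] /hasPn dis /hys[h' [g' d']]].
  do 2!eexists; apply: drains_serial d d' _ => i /touches_hgraph/andP[iy _].
  by apply/negP => /touches_chgraph/andP[/dis]; rewrite iy.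
Qed.

(** * Counting components *)

(** Points separated by an invariant of adjacency lie in different components. *)
Lemma invariant_n_comp (T I : finType) (Y : eqType) (e : rel T) (f : T -> Y)
    (z : I -> T) :
  symmetric e -> (forall a b, e a b -> f a = f b) -> injective (f \o z) ->
  (#|I| <= n_comp e predT)%N.
Proof.
move=> es ef fz; have fr a : f (fingraph.root e a) = f a.
  have /connectP[s sp ->] := connect_root e a.
  by elim: s a sp => //= b s IH a /andP[/ef -> /IH].
rewrite -(card_image (f := fingraph.root e \o z)); last first.
  by move=> i j /(congr1 f); rewrite /= !fr => /fz.
rewrite /n_comp_mem; apply/subset_leq_card/fintype.subsetP => _ /codomP[i ->].
by rewrite inE /= roots_root//; exact: sym_connect_sym.
Qed.

(** The invariant separating components is the label of a wire, or of a vertex that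
    has wires, and the vertex itself if it is thin. *)
Lemma ncomponents_ge c (t : term G c) :
  uniq (boxes t) -> (forall i, (G i).2 <= 1)%N ->
  (c.2 + #|[set i | thin (G i)]| <= ncomponents (hgraph t))%N.
Proof.
move=> ut r1; have [h [g [lab _ out]]] := drains_hgraph ut r1.
set w := hgraph t in lab out *.
pose wl (k : 'I_(size w)) := label id g (tnth (in_tuple w) k).2.
pose f (a : 'I_n + 'I_(size w)) : nat + 'I_n :=
  match a with
  | inl i => if thin (G i) then inr i else inl (g i)
  | inr k => inl (wl k)
  end.
have fwire i k : let: (s, t) := tnth (in_tuple w) k in
    at_box i s || at_box i t -> f (inl i) = inl (wl k).
  have := mem_tnth k (in_tuple w); rewrite /wl /=; case: (tnth _ k) => a b ab tab.
  have ti : touches w i by apply/hasP; exists (a, b).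
  have /andP[_ /negbTE ->] := touches_hgraph ti; congr inl.
  case/orP: tab => [|]; last by case: b {ab} => [//|[i' k']] /eqP ->.
  by move: (lab _ _ ab) => /=; case: a {ab} => [//|[i' k']] /= <- /eqP ->.
have out' (j : 'I_c.2) : exists k, wl k == j.
  have [s sj] := out j (ltn_ord j).
  have /tnthP[k ek] : (s, inl (nat_of_ord j)) \in in_tuple w by [].
  by exists k; rewrite /wl -ek.
pose z (a : 'I_c.2 + {i | i \in [set i | thin (G i)]}) : 'I_n + 'I_(size w) :=
  match a with inl j => inr (xchoose (out' j)) | inr i => inl (val i) end.
have := @invariant_n_comp _ _ _ (@adjacent n w) f z.
rewrite card_sum card_ord card_sig; apply.
- by move=> [a|a] [b|b].
- move=> [a|a] [b|b] //=; rewrite /adjacent.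
    by move: (fwire a b) => /=; case: (tnth _ _) => u v /[apply].
  by move: (fwire b a) => /=; case: (tnth _ _) => u v /[apply] ->.
- move=> [j|[i hi]] [j'|[i' hi']] /=; rewrite ?(eqP (xchooseP (out' _))).
  + by case=> /val_inj ->.
  + by have := hi'; rewrite inE => ->.
  + by have := hi; rewrite inE => ->.
  + have := hi; have := hi'; rewrite !inE => -> -> [e]; congr inr; exact: val_inj.
Qed.

End Terms.

(** * Vanishing on zero inputs *)

Section ZeroInputs.
Variables (k : comPzRingType) (U : smallCat) (A : quiverOn k U).
Local Notation C := (cochain A).
Local Notation H V := (@qhom k (A V)).

Fixpoint has_zero p0 l (ths : chain C p0 l) : Prop :=
  match ths with
  | cnil _ => False
  | ccons _ _ _ _ th ths' => th = 0 \/ has_zero ths'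
  end.

(** [tens] is only a formal sum of elementary tensors, so its vanishing has to be
    tested against multilinear maps. *)
Lemma tens_zero p0 l (ths : chain C p0 l) V X (s : psimplex p0 V X)
    (f : dinj (clast p0 l) p0) (a b : A X) (w : mpath (H X) (cqs l) a b)
    (N : A V -> lmodType k)
    (F : forall b, mpath (H V) (size l) (pull A s a) b -> N b) :
  has_zero ths -> multilin F -> \sum_(v <- tens ths s f w) F _ v = 0.
Proof.
elim: ths s f a b w N F => [{}p0|{}p0 q p1 {}l th ths IH] s f a b w N F //= hz hF.
case: (msplit w) => m [w1 w2].
rewrite big_flatten big_map big1 // => f1 _.
rewrite big_flatten big_map big1 // => f2 _.
case: eqP => e; last by rewrite big_nil.
rewrite big_map; case: hz => [->|hz].
  rewrite big1 // => v _; set w' := mend _ _.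
  have lin := (hF _).1 _ w' (-1) 0 0.
  by move: lin; rewrite scaler0 addr0 scaleN1r addNr.
(* The end points differ by a transport along f2(f1(sigma)) = f(sigma), whose sides are
   not convertible; it disappears after generalizing the right-hand simplex. *)
have E : face f2 (face f1 s) = face f s by rewrite face_dcomp e.
suff gen tau (E' : face f2 (face f1 s) = tau)
    (eb : pull A (face f2 (face f1 s)) b = pull A tau b) u :
    \sum_(v <- tens ths (face f1 s) f2 w2) F _ (pcons u (mend eb v)) = 0.
  exact: (gen _ E (face_dcomp_end s b e)).
case: _ / E' in eb *; rewrite (Prop_irrelevance eb erefl) /=.
exact: IH hz ((hF _).2 u).
Qed.

Lemma cochain_comp0l p m r p0 l (ths : chain C p0 l) (e : size l = m) :
  cochain_comp (0 : C (p, m, r)) ths e = 0.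
Proof.
apply: cochainP => V X s f a b w /=; rewrite /comp_fun; case: eqP => // ef.
rewrite big1 //.
have := hcast_linear (pull_split s a) (pull_face_split s ef b) (-1) 0 0.
by rewrite scaler0 addr0 scaleN1r addNr.
Qed.

Lemma cochain_comp0r p m r p0 l (x : C (p, m, r)) (ths : chain C p0 l)
    (e : size l = m) : has_zero ths -> cochain_comp x ths e = 0.
Proof.
case: m / e x => x hz.
apply: cochainP => V X s f a b w /=; rewrite /comp_fun; case: eqP => // ef.
rewrite (tens_zero _ _ hz); last exact: cofun_multilin.
have := hcast_linear (pull_split s a) (pull_face_split s ef b) (-1) 0 0.
by rewrite scaler0 addr0 scaleN1r addNr.
Qed.

(** Composition of cochains is linear in each argument, so a zero propagates from a box
    to the whole composite. *)
Lemma eval_zero n (G : {ffun 'I_n -> colour}) (x : forall i, cochain_box A (G i))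
    c (t : term G c) i :
  i \in boxes t -> x i = 0 -> eval x t = 0.
Proof.
move=> + xi.
elim/(@term_chain_ind n G (fun p0 l ys =>
  i \in cfold (fun=> [::]) (@boxes n G) cat ys -> has_zero (cmap (eval x) ys))): c / t.
- by move=> i' c e; rewrite mem_seq1 => /eqP ei; subst; rewrite /= xi.
- by [].
- move=> p m r p0 l y ys e hy hys; rewrite mem_cat => /orP[/hy|/hys] /=.
    by move=> ->; exact: cochain_comp0l.
  exact: cochain_comp0r.
- by [].
- move=> p0 q p1 l y ys hy hys; rewrite mem_cat => /orP[/hy|/hys] /=; first by left.
  by right.
Qed.

End ZeroInputs.

(** * The Gerstenhaber-Schack subobject *)

Section GS.
Variables (k : comPzRingType) (U : smallCat) (A : quiverOn k U).

Lemma sCGSP d (x : Tot (cochain_box A) d) :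
  sCGS x <-> forall c e, (forall p q, c <> gs_box p q) -> x c e = 0.
Proof.
split=> [[y []]//|h]; exists (fun p q _ => component x (gs_box p q)).
split=> // p q _ e; rewrite /component; case: eqP => // e'.
by rewrite (Prop_irrelevance e e').
Qed.

Lemma component_sCGS d (x : Tot (cochain_box A) d) c :
  sCGS x -> (forall p q, c <> gs_box p q) -> component x c = 0.
Proof. by move=> /sCGSP h hc; rewrite /component; case: eqP => // e; apply: h. Qed.

End GS.

(** * Thin-quadratic stackings *)

Lemma td_dd c : td c = dd c + (~~ thin c)%:Z.
Proof. by case: c => [[[|p] q] [|r]]; rewrite /td /dd /thin /=; lia. Qed.

Lemma card_thin_inputs n c (S : stacking n c) : td_deg S = 2 - n%:Z ->
  #|[set i | thin (inputs S i)]| = (thin c).+1.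
Proof.
rewrite /td_deg (eq_bigr _ (fun i _ => td_dd (inputs S i))) big_split /= td_dd.
have -> : dd c = \sum_i dd (inputs S i).
  by rewrite (dd_boxes (rep S)) (perm_big _ (term_ofP (rep S))) big_enum.
rewrite -(big_morph Posz PoszD erefl).
set D : int := \sum_i dd _; set m := (\sum_i ~~ _)%N => h.
have en : (m + #|[set i | thin (inputs S i)]|)%N = n.
  rewrite /m -sum1dep_card [X in (_ + X)%N]big_mkcond -big_split /=.
  rewrite -[RHS](card_ord n) -sum1_card.
  by apply: eq_bigr => i _; case: thin.
by move: D m #|_| h en => D m a; case: (thin c) => /=; lia.
Qed.

(** If [c] is not thin, S has two components, one of which is a thin box; the other
    one leaves room for a single global output. *)
Lemma thin_quadratic_output n c (S : stacking n c) :
  thin_quadratic S -> (forall i, exists p q, inputs S i = gs_box p q) ->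
  exists p q, c = gs_box p q.
Proof.
case=> dS _ nS _ inS.
have r1 i : ((inputs S i).2 <= 1)%N by have [[|p] [q ->]] := inS i.
have pr : (c.1.1 == 0%N) = (c.2 == 0%N).
  by apply: (inputless_outputless (rep S)) => i; have [[|p] [q ->]] := inS i.
have uS : uniq (boxes (rep S)) by rewrite (perm_uniq (term_ofP _)) enum_uniq.
have := ncomponents_ge uS r1; rewrite nS (card_thin_inputs dS).
move: pr; case: (c) => [[p q] r]; rewrite /thin /=.
case: p => [|p] /=; case: r => [|[|r]] //=; last by lia.
  by exists 0%N, q.
by exists p.+1, q.
Qed.

Theorem proposition4p7 (k : comPzRingType) (U : smallCat) (A : quiverOn k U) :
  Linfty_admissible_subalgebra (sCGS (A := A)).
Proof.
split=> [d|n _ d x /= hx].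
  split=> [|l x y /sCGSP hx /sCGSP hy]; apply/sCGSP => // c e hc.
  by rewrite -[LHS]/(l *: x c e + y c e) hx// hy// scaler0 addr0.
apply/sCGSP => c e hc; apply: fsbig1 => S /= tS.
have [i hi] : exists i, forall p q, inputs S i <> gs_box p q.
  apply: contrapT => /forallNP no.
  have [|p [q]] := thin_quadratic_output tS; last exact: hc.
  move=> i; have /existsNP[p /existsNP[q /contrapT ->]] := no i.
  by exists p, q.
rewrite /td_op (@eval_zero _ _ _ _ _ _ _ _ i) ?scaler0//.
  by rewrite (perm_mem (term_ofP _)) mem_enum.
exact: component_sCGS.
Qed.
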